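(* Consider the statistical model with $x\in\mathbb Z$ and $\theta\in\Theta=\mathbb Z$ given by $$p(x\mid\theta)=\begin{cases}\frac13 & \text{if }\theta\ge 1,\ x\in\{[\theta/2],\,2\theta,\,2\theta+1\},\\ 1 & \text{if }\theta\le 0,\ x=\theta,\\ 0&\text{otherwise,}\end{cases}$$ where $[l]$ denotes the integer part of $l$, with the particular convention $[1/2]=1$. Let $\pi(\theta)\propto 1$ be the flat prior on $\mathbb Z$. Let $K_n=\{\theta\in\mathbb Z: -a_n\le\theta\le b_n\}$ be an exhaustive increasing sequence of compact sets, where $a_n,b_n$ are integers with $a_n,b_n\to+\infty$, and let $$I_n=\sum_{x\in\mathbb Z}p_n(x)\,\kappa\big(\pi(\cdot\mid x),\pi_n(\cdot\mid x)\big).$$ Then, as $n\to\infty$, $$I_n\sim\frac{\ln 3}{2}\,\frac{b_n}{a_n+b_n+1}.$$ Consequently, if $b_n/a_n\to0$ then $\lim_n I_n=0$, so that the sequence of posteriors $\pi_n(\theta\mid x)$ is expected logarithmically convergent to $\pi(\theta\mid x)$; whereas if $a_n=b_n$ for all $n$ then $\lim_n I_n=\frac{\ln 3}{4}$, so that it is not. In particular, expected logarithmic convergence may depend on the choice of the sequence of compact sets.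
   Context: $\mathbb Z$ carries the discrete topology and counting measure, so compact sets are finite sets and integrals are sums. For a prior $\pi$ and an exhaustive increasing sequence of compact sets $K_n$ (i.e. with union $\Theta$), the truncated proper prior is $\pi_n(\theta)\propto\pi(\theta)\mathbf 1_{\theta\in K_n}$, normalized to be a probability. The marginal is $p_n(x)=\sum_{\theta}p(x\mid\theta)\pi_n(\theta)$, and the posteriors are $\pi(\theta\mid x)\propto p(x\mid\theta)\pi(\theta)$ and $\pi_n(\theta\mid x)\propto p(x\mid\theta)\pi_n(\theta)$, the latter for $x$ with $p_n(x)>0$; values of $x$ with $p_n(x)=0$ contribute $0$ to the sum $I_n$. Here $\kappa(m_1,m_2)$ is the Kullback-Leibler divergence between probability measures, with $\kappa(m_1,m_2)=\sum_\theta m_2(\theta)\ln\frac{m_2(\theta)}{m_1(\theta)}$ (convention $0\ln 0=0$). The sequence $\pi_n(\theta\mid x)$ is said to be expected logarithmically convergent to $\pi(\theta\mid x)$ if $\lim_{n\to\infty}\sum_x p_n(x)\,\kappa(\pi(\cdot\mid x),\pi_n(\cdot\mid x))=0$. *)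

(* Defs.v *)
From HB Require Import structures.
From mathcomp Require Import all_boot all_order all_algebra.
From mathcomp Require Import all_classical all_reals all_analysis.

Set Implicit Arguments.
Unset Strict Implicit.
Unset Printing Implicit Defensive.

Import Order.TTheory GRing.Theory Num.Theory.
Import numFieldNormedType.Exports.

Local Open Scope classical_set_scope.
Local Open Scope ring_scope.

Section discrete_bayes.
Context {R : realType}.

(* [esum] is meant for nonnegative terms; the sum of a signed family is the
   difference of the sums of its positive and negative parts, that is, its
   integral against the counting measure. *)
Definition dsum (T : choiceType) (f : T -> \bar R) : \bar R :=
  (\esum_(t in [set: T]) f^\+ t - \esum_(t in [set: T]) f^\- t)%E.

(* The probability mass function proportional to [f]; meaningful when
   [f >= 0] has a positive finite total mass. *)
Definition normalize (T : choiceType) (f : T -> R) (t : T) : R :=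
  f t / fine (dsum (EFin \o f)).

(* The paper's kappa(m1, m2): the reference measure m1 comes first. *)
Definition kullback_leibler (T : choiceType) (m1 m2 : T -> R) : \bar R :=
  dsum (fun t => if m2 t == 0 then 0%E
                 else if m1 t == 0 then +oo%E
                 else (m2 t * ln (m2 t / m1 t))%:E).

(* Equality of (possibly improper) priors up to normalization. *)
Definition proportional (T : Type) (f g : T -> R) : Prop :=
  exists2 c : R, 0 < c & forall t, f t = c * g t.

Context {X T : choiceType}.

(* The parameter space is discrete, so its compact sets are the finite ones.
   The K_n are nonempty: otherwise the prior truncated to K_n cannot be
   normalized. *)
Definition exhaustive_compacts (K : nat -> set T) : Prop :=
  [/\ forall n, finite_set (K n),
      forall n, K n !=set0,
      forall n, K n `<=` K n.+1
    & \bigcup_n K n = [set: T]].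

(* A model [p x t] is the probability of the observation [x] given [t]. *)
Implicit Types (p : X -> T -> R) (pi : T -> R) (K : nat -> set T).

Definition truncated_prior pi K (n : nat) : T -> R :=
  normalize (fun t => pi t * \1_(K n) t).

Definition marginal p pi (x : X) : \bar R :=
  dsum (fun t => (p x t * pi t)%:E).

Definition posterior p pi (x : X) : T -> R :=
  normalize (fun t => p x t * pi t).

(* I_n *)
Definition expected_kl p pi K (n : nat) : \bar R :=
  let pin := truncated_prior pi K n in
  dsum (fun x => if marginal p pin x == 0%E then 0%E
    else (marginal p pin x *
            kullback_leibler (posterior p pi x) (posterior p pin x))%E).

Definition expected_log_convergent p pi K : Prop :=
  expected_kl p pi K @ \oo --> 0%E.

End discrete_bayes.

(* The integer part of t/2, with the convention [1/2] = 1. *)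
Definition half_part (t : int) : int :=
  if t == 1 then 1 else (t %/ 2)%Z.

Definition example_model (R : realType) (x t : int) : R :=
  if (1 <= t) && (x \in [:: half_part t; 2 * t; 2 * t + 1]) then 3^-1
  else if (t <= 0) && (x == t) then 1
  else 0.

(* Main.v *)
(* On the positive integers the relation "x is observable under theta" is
   symmetric and 3-regular, so the posterior given x >= 1 is uniform on three
   points and the truncated one is uniform on the k of them that lie in [K_n];
   such an x contributes k ln (3 / k) / (3 N) to I_n, where N = a + b + 1. Given
   x <= 0 both posteriors are Dirac. All three points lie in [-a, b] when
   x < [b/2], and only one does when [b/2] < x <= 2b + 1, so I_n is
   (3b/2 + O(1)) ln 3 / (3 N). *)
Require Import Defs.
From HB Require Import structures.
From mathcomp Require Import all_boot all_order all_algebra.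
From mathcomp Require Import all_classical all_reals all_analysis.
From mathcomp Require Import zify ring lra.

Set Implicit Arguments.
Unset Strict Implicit.
Unset Printing Implicit Defensive.

Import Order.TTheory GRing.Theory Num.Theory.
Import numFieldNormedType.Exports.

Local Open Scope classical_set_scope.
Local Open Scope ring_scope.

(** * Finitely supported sums and divergences between uniform laws *)

Section uniform.
Context {R : realType}.

Definition uniform (T : choiceType) (s : seq T) (t : T) : R :=
  (t \in s)%:R / (size s)%:R.

Lemma esum_seq (T : choiceType) (s : seq T) (f : T -> \bar R) : uniq s ->
  (forall t, (0 <= f t)%E) -> (forall t, t \notin s -> f t = 0%E) ->
  (\esum_(t in [set: T]) f t = \sum_(t <- s) f t)%E.
Proof.
move=> us f0 fs; rewrite fsbig_seq // -esum_fset // [RHS]esum_mkcond.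
apply: eq_esum => t _; case: ifPn => //; rewrite mem_setE; exact: fs.
Qed.

Lemma dsum_seq (T : choiceType) (s : seq T) (f : T -> R) : uniq s ->
  (forall t, t \notin s -> f t = 0) ->
  dsum (fun t => (f t)%:E) = (\sum_(t <- s) f t)%:E.
Proof.
move=> us fs; rewrite /dsum !(esum_seq us).
  under eq_bigr do rewrite funeposE -EFin_max.
  under [X in (_ - X)%E]eq_bigr do rewrite funenegE -EFinN -EFin_max.
  rewrite !sumEFin -EFinB -sumrB; congr EFin; apply: eq_bigr => t _.
  by rewrite !maxEle; case: ifPn; case: ifPn; lra.
- by move=> t; exact: funeneg_ge0.
- by move=> t /fs ft; rewrite funenegE ft oppe0 maxxx.
- by move=> t; exact: funepos_ge0.
- by move=> t /fs ft; rewrite funeposE ft maxxx.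
Qed.

Lemma sum_mem (T : choiceType) (s1 s2 : seq T) :
  \sum_(t <- s1) (t \in s2)%:R = (count (mem s2) s1)%:R :> R.
Proof.
rewrite -sum1_count natr_sum [RHS]big_mkcond; apply: eq_bigr => t _.
by rewrite -[mem s2 t]/(t \in s2); case: ifP.
Qed.

Lemma dsum_indic (T : choiceType) (c : R) (s : seq T) : uniq s ->
  dsum (fun t => (c * (t \in s)%:R)%:E) = (c * (size s)%:R)%:E.
Proof.
move=> us; rewrite (dsum_seq us) => [|t /negbTE ->]; last by rewrite mulr0.
rewrite -mulr_sumr sum_mem; congr (c * _%:R)%:E.
by apply/eqP; rewrite -all_count; apply/allP.
Qed.

(** The factor [c] cancels. An empty [s] is allowed: both sides are then zero, since dividing by
    zero yields 0. *)
Lemma normalize_indic (T : choiceType) (c : R) (s : seq T) : c != 0 -> uniq s ->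
  normalize (fun t => c * (t \in s)%:R) = uniform s.
Proof.
move=> c0 us; apply/funext => t.
by rewrite /normalize /comp dsum_indic //= -mulf_div divff // mul1r.
Qed.

(** The inclusion of [s2] in [s1] rules out the infinite branch, and the log-ratio is constant on
    [s2]. *)
Lemma kullback_leibler_uniform (T : choiceType) (s1 s2 : seq T) :
  uniq s2 -> s2 != [::] -> {subset s2 <= s1} ->
  kullback_leibler (uniform s1) (uniform s2) =
  (ln ((size s1)%:R / (size s2)%:R))%:E.
Proof.
move=> us2 s20 s21; rewrite /kullback_leibler.
have k20 : (size s2)%:R != 0 :> R by rewrite pnatr_eq0 size_eq0.
have k10 : (size s1)%:R != 0 :> R.
  rewrite pnatr_eq0 size_eq0; case: s2 s20 s21 {us2 k20} => // t s _.
  by move=> /(_ t); rewrite mem_head; case: s1 => // /(_ isT).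
set c := ln _.
transitivity (dsum (fun t => (c / (size s2)%:R * (t \in s2)%:R)%:E)).
  congr dsum; apply/funext => t; rewrite /uniform.
  have [ts2|ts2] := boolP (t \in s2); last by rewrite mul0r eqxx mulr0.
  rewrite (s21 _ ts2) !mul1r !invr_eq0 (negbTE k20) (negbTE k10) invrK mulr1.
  by rewrite [in LHS]mulrC [_^-1 * _]mulrC.
by rewrite dsum_indic // mulfVK.
Qed.

(* Unnormalized divergence of the uniform law on [k] points from the uniform
   law on [m] points containing them; at [k = 0] the factor [k] kills the junk
   value of [ln (m / 0)], in accordance with the convention of [expected_kl]. *)
Definition defect (m k : nat) : R := k%:R * ln (m%:R / k%:R).

Lemma defect_id m : defect m m = 0.
Proof.
case: m => [|m]; first by rewrite /defect mul0r.
by rewrite /defect divff ?pnatr_eq0 // ln1 mulr0.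
Qed.

Lemma defect_bounds (m k : nat) : (k <= m)%N -> 0 <= defect m k <= m%:R * ln m%:R.
Proof.
case: k => [|k] km.
  rewrite /defect mul0r lexx; case: m {km} => [|m]; first by rewrite mul0r lexx.
  by rewrite mulr_ge0 // ln_ge0 // ler1n.
have k0 : 0 < k.+1%:R :> R by rewrite ltr0n.
have m0 : 0 < m%:R :> R by rewrite ltr0n (leq_trans _ km).
have h1 : 1 <= m%:R / k.+1%:R :> R by rewrite ler_pdivlMr // mul1r ler_nat.
apply/andP; split; first by rewrite mulr_ge0 // ln_ge0.
rewrite ler_pM ?ln_ge0 ?ler_nat // ler_ln ?posrE ?divr_gt0 //.
by rewrite ler_pdivrMr // ler_peMr ?ler1n // ltW.
Qed.

(* With a flat prior and observations that are uniform on their preimages, the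
   posteriors are uniform on [S x] and on its trace on [K n]. *)
Lemma expected_kl_uniform (X T : choiceType) (p : X -> T -> R) (w : X -> R)
    (S : X -> seq T) (pi : T -> R) (K : nat -> set T) (n : nat) (s : seq T) :
  (forall x, 0 < w x) -> (forall x, uniq (S x)) ->
  (forall x t, p x t = w x * (t \in S x)%:R) ->
  proportional pi (fun=> 1) -> K n = [set` s] -> uniq s -> s != [::] ->
  expected_kl p pi K n =
  dsum (fun x => (w x / (size s)%:R *
                  defect (size (S x)) (count (mem s) (S x)))%:E).
Proof.
move=> w0 uS pE [c c0 piE] KE us s0.
have N0 : 0 < (size s)%:R :> R by rewrite ltr0n lt0n size_eq0.
have pinE : truncated_prior pi K n = uniform s.
  rewrite -(@normalize_indic _ c) ?gt_eqF //; congr normalize.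
  by apply/funext => t; rewrite piE mulr1 indicE KE mem_setE.
(* The joint weight is again a constant times an indicator, that of the trace of [S x] on [s]; the
   marginal and the truncated posterior are both read off from it. *)
have jointE x : (fun t => p x t * uniform s t) =
    (fun t => w x / (size s)%:R * (t \in [seq t <- S x | t \in s])%:R).
  apply/funext => t; rewrite pE /uniform mem_filter -mulnb natrM.
  by ring.
have uF x : uniq [seq t <- S x | t \in s] by rewrite filter_uniq.
have wN0 x : w x / (size s)%:R != 0 by rewrite gt_eqF // divr_gt0.
have margE x : marginal p (uniform s) x =
    (w x / (size s)%:R * (count (mem s) (S x))%:R)%:E.
  rewrite /marginal -[X in dsum X]/(EFin \o (fun t => p x t * uniform s t)).
  by rewrite jointE -[EFin \o _]/(fun t => _%:E) dsum_indic // size_filter.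
rewrite /expected_kl pinE; congr dsum; apply/funext => x.
rewrite margE /posterior jointE normalize_indic //.
have -> : normalize (fun t => p x t * pi t) = uniform (S x).
  rewrite -(@normalize_indic _ (w x * c)) ?gt_eqF ?mulr_gt0 //; congr normalize.
  by apply/funext => t; rewrite pE piE mulr1 mulrAC.
have [k0|k0] := eqVneq (count (mem s) (S x)) 0%N.
  by rewrite k0 /defect mul0r !mulr0 eqxx.
rewrite eqe mulf_eq0 (negbTE (wN0 x)) pnatr_eq0 (negbTE k0) /=.
rewrite kullback_leibler_uniform // ?size_filter //.
- by rewrite -EFinM mulrA.
- by rewrite -size_eq0 size_filter.
- by move=> t; rewrite mem_filter => /andP[].
Qed.

End uniform.

(** * Integer intervals as duplicate-free lists *)

Definition interval_seq (a b : int) : seq int :=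
  [seq a + i%:Z | i <- iota 0 `|(b - a + 1)%R|%N].

Lemma mem_interval_seq (a b t : int) : a <= b ->
  (t \in interval_seq a b) = (a <= t <= b).
Proof.
move=> ab; apply/mapP/idP => [[i]|tab]; first by rewrite mem_iota; lia.
by exists `|(t - a)%R|%N; rewrite ?mem_iota; lia.
Qed.

Lemma interval_seq_uniq (a b : int) : uniq (interval_seq a b).
Proof. by rewrite map_inj_uniq ?iota_uniq // => i j; lia. Qed.

Lemma interval_seqE (a b : int) : a <= b ->
  [set t : int | a <= t <= b] = [set` interval_seq a b].
Proof. by move=> ab; apply/seteqP; split=> t /=; rewrite mem_interval_seq. Qed.

(** * The example model: exact value and leading term of the expected divergence *)

Section model.
Context {R : realType}.

Definition preimages (x : int) : seq int :=
  if 1 <= x then [:: half_part x; 2 * x; 2 * x + 1] else [:: x].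

(** The weight depends on [x] alone because positive observations arise only from [t >= 1] and the
    others only from [t <= 0]. *)
Lemma example_modelE (x t : int) : @example_model R x t =
  (if 1 <= x then 3^-1 else 1) * (t \in preimages x)%:R.
Proof.
(* Halving [t] gives [x] exactly when [t] is [2 * x] or [2 * x + 1], except that 1 is its own half;
   that pair is symmetric anyway. *)
have sym : 1 <= x -> (1 <= t) && (x \in [:: half_part t; 2 * t; 2 * t + 1]) =
    (t \in [:: half_part x; 2 * x; 2 * x + 1]).
  by move=> x1; rewrite !inE /half_part; case: (x =P 1); case: (t =P 1); lia.
rewrite /example_model /preimages; case: (leP 1 x) => [x1|x1].
  rewrite sym //; case: ifP => _; first by rewrite mulr1.
  by rewrite mulr0; case: ifP => //; lia.
rewrite mul1r ifF; last first.
  by rewrite !inE /half_part; case: (t =P 1); lia.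
rewrite inE [x == t]eq_sym; case: (t =P x) => [->|_]; last by rewrite andbF.
by rewrite ifT //; lia.
Qed.

Lemma preimages_uniq (x : int) : uniq (preimages x).
Proof.
rewrite /preimages; case: ifP => //= x1; rewrite !inE /half_part.
by case: (_ =P 1); lia.
Qed.

Lemma size_preimages (x : int) : 1 <= x -> size (preimages x) = 3.
Proof. by rewrite /preimages => ->. Qed.

(** Terms with [x <= 0] or [x >= 2 * b + 2] vanish, so the sum is finite and any cutoff [M] from
    there on will do. *)
Lemma expected_kl_interval (pi : int -> R) (K : nat -> set int) (n M : nat)
    (a b : int) :
  proportional pi (fun=> 1) -> K n = [set t | - a <= t <= b] -> - a <= b ->
  2 * b + 2 <= M%:Z ->
  expected_kl (@example_model R) pi K n =
  ((\sum_(1 <= x < M)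
      defect 3 (count (mem (interval_seq (- a) b)) (preimages x%:Z))) /
     (3 * (a + b + 1)%:~R))%:E.
Proof.
move=> piE KE ab bM.
pose w (x : int) : R := if 1 <= x then 3^-1 else 1.
have N0 : interval_seq (- a) b != [::].
  by rewrite -size_eq0 size_map size_iota; lia.
rewrite (expected_kl_uniform (w := w) (S := preimages)
  (s := interval_seq (- a) b)) //.
- rewrite (@dsum_seq _ _ [seq x%:Z | x <- index_iota 1 M]).
  + rewrite big_map mulr_suml; congr EFin; apply: eq_big_nat => x /andP[x1 _].
    rewrite size_preimages ?lez_nat // /w lez_nat x1 mulrC -invfM size_map size_iota.
    congr (_ / (_ * _)).
    rewrite opprK addrAC addrC addrA pmulrn; congr (_%:~R); lia.
  + by rewrite map_inj_uniq ?iota_uniq // => i j; lia.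
  + move=> x xM; apply/eqP; rewrite mulf_eq0; apply/orP; right; apply/eqP.
    have [x1|x1] := leP 1 x.
      (* From [2 * b + 2] on, even the smallest of the three points, [half_part x], exceeds [b]. *)
      rewrite [count _ _](_ : _ = 0%N) ?/defect ?mul0r //; apply/eqP.
      rewrite -leqn0 leqNgt -has_count; apply/hasPn => t.
      have xbig : M%:Z <= x.
        rewrite leNgt; apply: contra xM => xM; apply/mapP; exists `|x|%N; last lia.
        by rewrite mem_index_iota; lia.
      rewrite /= mem_interval_seq // /preimages x1 !inE /half_part.
      by case: (_ =P 1); lia.
    (* A single preimage is kept or lost: the count is 1 or 0, and the defect vanishes either
       way. *)
    rewrite /preimages leNgt x1 /=; case: (_ \in _) => /=.
      by rewrite defect_id.
    by rewrite /defect mul0r.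
- by move=> x; rewrite /w; case: ifP.
- exact: preimages_uniq.
- exact: example_modelE.
- by rewrite KE interval_seqE.
- exact: interval_seq_uniq.
Qed.

(* Only [x = B/2], where [2x] and [2x + 1] may be separated by [B], contributes
   an amount other than [0] or [ln 3]. *)
Lemma sum_defect (a : int) (B : nat) : 0 <= a -> (2 <= B)%N ->
  exists2 e : R, 0 <= e <= 3 * ln 3 &
  \sum_(1 <= x < 2 * B + 2)
    defect 3 (count (mem (interval_seq (- a) B)) (preimages x%:Z)) =
  (2 * B + 1 - B./2)%:R * ln 3 + e.
Proof.
move=> a0 B2.
set c := fun x : nat => count (mem (interval_seq (- a) B)) (preimages x%:Z).
(* All three preimages are positive and [- a <= 0], so only the upper end [B] can exclude them. *)
have cE (x : nat) : (1 <= x)%N -> c x =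
    ((half_part x%:Z <= B%:Z)%R + (2 * x <= B) + (2 * x + 1 <= B))%N.
  move=> x1; rewrite /c /preimages lez_nat x1 /= !mem_interval_seq; [|lia..].
  by rewrite /half_part; case: (_ =P 1); lia.
exists (defect 3 (c B./2)).
  by apply: defect_bounds; rewrite cE; lia.
(* Below [B./2] all three points are at most [B]; beyond it, up to [2 * B + 1], only [half_part x]
   is. *)
rewrite (big_cat_nat (n := B./2)) /=; [|lia..].
rewrite big_nat big1 ?add0r; last first.
  move=> x xB; rewrite -/(c x) cE; last lia.
  rewrite [X in defect 3 X](_ : _ = 3) ?defect_id //.
  by rewrite /half_part; case: (_ =P 1); lia.
rewrite big_ltn -/(c _); last lia.
rewrite addrC; congr (_ + _).
rewrite (eq_big_nat _ _ (F2 := fun=> ln 3)); last first.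
  move=> x xB; rewrite -/(c x) cE; last lia.
  rewrite [X in defect 3 X](_ : _ = 1%N) /defect ?mul1r ?divr1 //.
  by rewrite /half_part; case: (_ =P 1); lia.
rewrite sumr_const_nat -[LHS]mulr_natl; congr (_%:R * _); lia.
Qed.

Definition leading (a b : int) : R := ln 3 / 2 * (b%:~R / (a + b + 1)%:~R).

(** The rounding in [B./2] and the boundary term together cost at most [3 / 2 * ln 3] over
    [a + b + 1], which is a relative error of [3 / b]. *)
Lemma expected_kl_leading (pi : int -> R) (K : nat -> set int) (n : nat)
    (a b : int) :
  proportional pi (fun=> 1) -> K n = [set t | - a <= t <= b] -> 0 <= a -> 2 <= b ->
  `|fine (expected_kl (@example_model R) pi K n) - leading a b|
  <= 3 / b%:~R * leading a b.
Proof.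
move=> piE KE a0 b2.
case: b => // B in KE b2 *.
rewrite (expected_kl_interval (M := 2 * B + 2) piE KE) /=; [|lia..].
have [e /andP[e0 e3] ->] := sum_defect a0 b2.
have L0 : 0 < ln 3 :> R by rewrite ln_gt0 // ltr1n.
rewrite /leading -pmulrn.
have N0 : 0 < (a + B%:Z + 1)%:~R :> R by rewrite ltr0z; lia.
have B0 : 0 < B%:R :> R by rewrite ltr0n; lia.
set N : R := (a + B%:Z + 1)%:~R in N0 *; set L := ln 3 in L0 e3 *; clearbody N L.
have -> : 3 / B%:R * (L / 2 * (B%:R / N)) = 3 / 2 * L / N :> R.
  by field; rewrite ?(gt_eqF N0) ?(gt_eqF B0).
(* Here [d] collects the constant 1 and the half lost by [B./2] when [B] is odd. *)
have [d /andP[d1 d2] ->] : exists2 d : R, 1 <= d <= 3 / 2 &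
    (2 * B + 1 - B./2)%:R = 3 / 2 * B%:R + d.
  exists (1 + (odd B)%:R / 2).
    by apply/andP; split; case: (odd B) => /=; lra.
  have BE : B%:R = (odd B)%:R + 2 * (B./2)%:R :> R.
    by rewrite -{1}(odd_double_half B) natrD -mul2n natrM.
  have -> : (2 * B + 1 - B./2 = 3 * B./2 + (odd B + (odd B + 1)))%N by lia.
  by rewrite BE natrD natrM natrD natrD; lra.
have -> : ((3 / 2 * B%:R + d) * L + e) / (3 * N) - L / 2 * (B%:R / N)
   = (d * L + e) / 3 / N by field; rewrite ?(gt_eqF N0) ?(gt_eqF B0).
rewrite ger0_norm; last by rewrite !divr_ge0 ?addr_ge0 ?mulr_ge0 //; lra.
rewrite ler_pM2r ?invr_gt0 //.
have : d * L <= 3 / 2 * L by rewrite ler_pM2r.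
lra.
Qed.

End model.

(** * Limits along a sequence of intervals *)

Section asymptotics.
Context {R : realType}.
Variables (pi : int -> R) (a b : nat -> int).
Let K n := [set t : int | - a n <= t <= b n].
Let I := expected_kl (@example_model R) pi K.
Let g n : R := leading (a n) (b n).
Hypothesis flat_pi : proportional pi (fun=> 1).
Hypothesis K_exhaustive : exhaustive_compacts K.
Hypothesis a_infty : (fun n => (a n)%:~R : R) @ \oo --> +oo.
Hypothesis b_infty : (fun n => (b n)%:~R : R) @ \oo --> +oo.

(** Since [K n] is inhabited, [- a n <= b n], and the closed form applies. *)
Lemma expected_kl_fin_num n : I n \is a fin_num.
Proof.
case: K_exhaustive => _ /(_ n) [t tK] _ _.
have {}tK : - a n <= t <= b n := tK.
by rewrite /I (@expected_kl_interval _ _ _ _ `|(2 * b n + 2)%R|%N (a n) (b n)) //; lia.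
Qed.

Let near_bounds : \forall n \near \oo, 0 <= a n /\ 2 <= b n.
Proof.
near=> n; split; rewrite -(ler_int R); near: n; exact: cvgry_ge.
Unshelve. all: by end_near. Qed.

Let b_inv : (fun n => 3 / (b n)%:~R : R) @ \oo --> 0.
Proof.
rewrite -(mulr0 3); apply: cvgMr.
apply/gtr0_cvgV0 => //.
by near=> n; near: n; exact: cvgry_gt.
Unshelve. all: by end_near. Qed.

Let near_dist : \forall n \near \oo,
  `|fine (I n) - g n| <= 3 / (b n)%:~R * g n.
Proof.
by apply: filterS near_bounds => n [a0 b2]; exact: expected_kl_leading.
Qed.

Let g_ge0 : \forall n \near \oo, 0 <= g n.
Proof.
apply: filterS near_bounds => n [a0 b2].
by rewrite /g /leading mulr_ge0 // divr_ge0 ?ln_ge0 ?ler1n ?ler0z //; lia.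
Qed.

(** The relative error [3 / b n] tends to 0, so the difference is little-o of [g]. *)
Lemma expected_kl_equiv : (fun n => fine (I n)) ~_\oo g.
Proof.
apply/eqaddoP => e e0; near=> n.
have gn : 0 <= g n by near: n; exact: g_ge0.
rewrite (ger0_norm gn) (@le_trans _ _ (3 / (b n)%:~R * g n)) //.
  by near: n; exact: near_dist.
rewrite ler_wpM2r // (le_trans (ler_norm _)) //.
by near: n; move/cvgr0Pnorm_le: b_inv; exact.
Unshelve. all: by end_near. Qed.

(** Both limit claims reduce to [g]: the error is a vanishing factor times a convergent sequence. *)
Lemma expected_kl_cvg (l : R) : g @ \oo --> l -> I @ \oo --> l%:E.
Proof.
move=> gl; apply: cvg_EFin; first by near=> n; exact: expected_kl_fin_num.
have bg : (fun n => 3 / (b n)%:~R * g n) @ \oo --> (0 : R).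
  by rewrite -(mul0r l); exact: cvgM.
apply: (@squeeze_cvgr _ _ _ _ (fun n => g n - 3 / (b n)%:~R * g n)
                              (fun n => g n + 3 / (b n)%:~R * g n)).
- by apply: filterS near_dist => n; rewrite ler_distl.
- by rewrite -[X in _ --> X]subr0; exact: cvgB.
- by rewrite -[X in _ --> X]addr0; exact: cvgD.
Unshelve. all: by end_near. Qed.

Lemma expected_kl_cvg0 :
  (fun n => (b n)%:~R / (a n)%:~R : R) @ \oo --> 0 -> I @ \oo --> 0%E.
Proof.
move=> ba; apply: expected_kl_cvg.
rewrite -(mulr0 (ln 3 / 2)); apply: cvgMr.
(* Eventually [b / (a + b + 1) <= b / a]. *)
apply: (squeeze_cvgr _ (cvg_cst 0) ba); near=> n.
have [_ b2] : 0 <= a n /\ 2 <= b n by near: n; exact: near_bounds.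
have a0 : 0 < a n by rewrite -(ltr_int R); near: n; exact: cvgry_gt.
have b0 : 0 <= (b n)%:~R :> R by rewrite ler0z; lia.
rewrite divr_ge0 //=; last by rewrite ler0z; lia.
by rewrite ler_wpM2l // lef_pV2 ?posrE ?ltr0z ?ler_int //; lia.
Unshelve. all: by end_near. Qed.

Lemma expected_kl_cvg_diag :
  (forall n, a n = b n) -> I @ \oo --> (ln 3 / 4)%:E.
Proof.
move=> ab; apply: expected_kl_cvg.
have -> : ln 3 / 4 = ln 3 / 2 * 2^-1 :> R by field.
apply: cvgMr.
(* On the diagonal the ratio is [b / (2 * b + 1)]; the crude lower bound is chosen so that [b_inv]
   can be reused. *)
apply: (@squeeze_cvgr _ _ _ _ (fun n => 2^-1 - 3 / (b n)%:~R) (fun=> 2^-1)).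
- apply: filterS near_bounds => n [_ b2]; rewrite ab !intrD.
  have b0 : 2 <= (b n)%:~R :> R by rewrite (ler_int _ 2).
  set x : R := (b n)%:~R in b0 *.
  have x0 : 0 < x by lra.
  have y0 : 0 < x + x + 1 by lra.
  rewrite ler_pdivlMr // ler_pdivrMr //; apply/andP; split; last lra.
  have -> : (2^-1 - 3 / x) * (x + x + 1) = x - 6 + 2^-1 - 3 / x.
    by field; rewrite gt_eqF.
  have : 0 <= 3 / x by rewrite divr_ge0 // ltW.
  lra.
- by rewrite -[X in _ --> X]subr0; apply: cvgB => //; exact: cvg_cst.
- exact: cvg_cst.
Unshelve. all: by end_near. Qed.

Lemma not_convergent_diag : (forall n, a n = b n) ->
  ~ expected_log_convergent (@example_model R) pi K.
Proof.
move=> /expected_kl_cvg_diag/fine_cvg I4 /fine_cvg I0.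
have /eqP : ln 3 / 4 = 0 :> R by exact: (cvg_unique _ I4 I0).
by rewrite gt_eqF // divr_gt0 // ln_gt0 // ltr1n.
Qed.

End asymptotics.

(** * Two exhaustions with opposite behaviour *)

Lemma exhaustive_intervals (a b : nat -> int) :
  (forall n, a n <= a n.+1) -> (forall n, b n <= b n.+1) ->
  (forall n, n%:Z <= a n) -> (forall n, n%:Z <= b n) ->
  exhaustive_compacts (fun n => [set t : int | - a n <= t <= b n]).
Proof.
move=> aS bS na nb; split.
- move=> n; have := na n; have := nb n => ? ?.
  rewrite interval_seqE; [exact: finite_seq|lia].
- by move=> n; exists 0; apply/andP; split; [have := na n|have := nb n]; lia.
- by move=> n t /=; have := aS n; have := bS n; lia.
- apply/seteqP; split=> // t _; exists `|t|%N => //.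
  by apply/andP; split; [have := na `|t|%N|have := nb `|t|%N]; lia.
Qed.

Lemma cvg_intr_pinfty (R : realType) (a : nat -> int) :
  (forall n, n%:Z <= a n) -> (fun n => (a n)%:~R : R) @ \oo --> +oo.
Proof.
move=> na; apply/cvgryPge => A; near=> n.
apply: (@le_trans _ _ n%:R); first by near: n; exact: nbhs_infty_ger.
by rewrite pmulrn ler_int.
Unshelve. all: by end_near. Qed.

Theorem mainTheorem3 (R : realType) (pi : int -> R)
    (flat_pi : proportional pi (fun=> 1)) :
  (forall a b : nat -> int,
    let K := fun n => [set t : int | - a n <= t <= b n] in
    let I := expected_kl (@example_model R) pi K in
    exhaustive_compacts K ->
    (fun n => (a n)%:~R : R) @ \oo --> +oo ->
    (fun n => (b n)%:~R : R) @ \oo --> +oo ->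
    [/\ (forall n, I n \is a fin_num) /\
        (fun n => fine (I n)) ~_\oo
          (fun n => ln 3 / 2 * ((b n)%:~R / (a n + b n + 1)%:~R)),
        (fun n => (b n)%:~R / (a n)%:~R : R) @ \oo --> 0 ->
          I @ \oo --> 0%E /\ expected_log_convergent (@example_model R) pi K
      & (forall n, a n = b n) ->
          I @ \oo --> (ln 3 / 4)%:E /\
          ~ expected_log_convergent (@example_model R) pi K]) /\
  (exists K1 K2 : nat -> set int,
    [/\ exhaustive_compacts K1, exhaustive_compacts K2,
        expected_log_convergent (@example_model R) pi K1
      & ~ expected_log_convergent (@example_model R) pi K2]).
Proof.
split=> [a b K I exK ay by_|].
  split.
  - split; first exact: expected_kl_fin_num.
    exact: expected_kl_equiv.
  - by move=> ba; split; exact: expected_kl_cvg0.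
  - by move=> ab; split; [exact: expected_kl_cvg_diag|exact: not_convergent_diag].
(* A quadratic left end makes [b n / a n] equal to [1 / n]; the second exhaustion is the symmetric
   one, with [b] at both ends. *)
pose b n : int := n%:Z; pose a n : int := (n * n)%N%:Z.
have na n : n%:Z <= a n by rewrite /a; nia.
have exa : exhaustive_compacts (fun n => [set t : int | - a n <= t <= b n]).
  by apply: exhaustive_intervals => // n; rewrite /a /b; nia.
have exb : exhaustive_compacts (fun n => [set t : int | - b n <= t <= b n]).
  by apply: exhaustive_intervals => // n; rewrite /b; lia.
do 2 eexists; split; [exact: exa|exact: exb| |].
- apply: expected_kl_cvg0 => //; try exact: cvg_intr_pinfty.
  have -> : (fun n => (b n)%:~R / (a n)%:~R : R) = (fun n => (b n)%:~R^-1).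
    apply/funext => n; rewrite /a PoszM intrM invfM mulrA.
    (* At [n = 0] the identity survives because the inverse of 0 is 0. *)
    have [->|n0] := eqVneq n 0%N; first by rewrite invr0 mulr0.
    by rewrite divff ?mul1r // intr_eq0.
  apply/gtr0_cvgV0; last exact: cvg_intr_pinfty.
  by apply: cvgry_gt; exact: cvg_intr_pinfty.
- by apply: not_convergent_diag => //; exact: cvg_intr_pinfty.
Qed.
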